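(* For every integer $n\ge 1$, the poset $P^A_n$ is self-dual; that is, there is a bijection $\psi\colon P^A_n\to P^A_n$ such that for all $p,q\in P^A_n$, $p<q$ if and only if $\psi(q)<\psi(p)$.
   Context: Let $[n]=\{1,2,\dots,n\}$. A permutation $p=p_1p_2\cdots p_n$ of $[n]$ (one-line notation) is 132-avoiding if there are no positions $1\le a<b<c\le n$ with $p_a<p_c<p_b$. Its descent set is $\mathrm{Des}(p)=\{i\in[n-1] : p_i>p_{i+1}\}$. $P^A_n$ is the poset whose elements are the 132-avoiding permutations of $[n]$, with strict order $p<q$ if and only if $\mathrm{Des}(p)\subsetneq\mathrm{Des}(q)$ (so distinct permutations with the same descent set are incomparable). *)

(* Defs.v *)
From HB Require Import structures.
From mathcomp Require Import all_boot all_order all_fingroup.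

Set Implicit Arguments.
Unset Strict Implicit.
Unset Printing Implicit Defensive.

(* Permutations of [n] are elements of 'S_n: positions and values are shifted
   down by one, so that p_(i+1) = (p i).+1 for i : 'I_n. *)
Definition avoids132 (n : nat) (p : 'S_n) : bool :=
  ~~ [exists a : 'I_n, exists b : 'I_n, exists c : 'I_n,
        [&& a < b, b < c, p a < p c & p c < p b]].

(* The condition j = i.+1 has no solution j : 'I_n at the last position, so Des
   p is contained in the first n - 1 positions, i.e. in [n-1] after the shift. *)
Definition Des (n : nat) (p : 'S_n) : {set 'I_n} :=
  [set i : 'I_n | [exists j : 'I_n, (j == i.+1 :> nat) && (p j < p i)]].

Record PA (n : nat) : Type :=
  MkPA { PA_perm :> 'S_n; PA_avoids : avoids132 PA_perm }.

HB.instance Definition _ (n : nat) := [isSub for @PA_perm n].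
HB.instance Definition _ (n : nat) := [Finite of PA n by <:].

Section PosetPA.
Variable n : nat.
Implicit Types p q r : PA n.

Definition PA_lt p q : bool := Des p \proper Des q.

Fact PA_lt_irr : irreflexive PA_lt.
Proof. by move=> p; rewrite /PA_lt properxx. Qed.

Fact PA_lt_trans : transitive PA_lt.
Proof. by move=> q p r; apply: proper_trans. Qed.

End PosetPA.

Fact PA_display : Order.disp_t. Proof. exact: Order.Disp tt tt. Qed.

(* The order built here is the reflexive closure of PA_lt, not inclusion of
   descent sets (which is only a preorder): distinct p, q with Des p = Des q
   are incomparable. *)
HB.instance Definition _ (n : nat) :=
  Order.Lt_isPOrder.Build PA_display (PA n)
    (@PA_lt_irr n) (@PA_lt_trans n).

Lemma ltPAE (n : nat) (p q : PA n) :
  (p < q)%O = (Des p \proper Des q).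
Proof. by []. Qed.

Lemma lePAE (n : nat) (p q : PA n) :
  (p <= q)%O = (p == q) || (Des p \proper Des q).
Proof. by []. Qed.

(* Main.v *)
Require Import Defs.
From mathcomp Require Import all_boot all_order all_fingroup.
From mathcomp Require Import zify.

(** A 132-avoiding permutation is encoded by the shape of its decreasing binary
    tree, whose inorder is the sequence of positions, and [i] is a descent
    exactly when node [i] has a right child; otherwise node [i + 1] has a left
    child.  Hence mirroring the tree complements the descent set and reverses
    it.  The mirrored tree belongs to the permutation that sends the [i]-th
    position from the right to the rank of node [i] in postorder. *)

Section OrderPermutations.
Set Implicit Arguments. Unset Strict Implicit.
Variable n : nat.

(** Each element is sent to its number of [R]-predecessors, a count that transitivity makes strictly
    monotone. This turns the postorder into a permutation. *)
Lemma perm_of_order (R : rel 'I_n) :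
    irreflexive R -> transitive R ->
    (forall i j, i != j -> R i j || R j i) ->
  exists s : 'S_n, forall i j, (s i < s j) = R i j.
Proof.
move=> Rirr Rtr Rtot.
have rank_lt i : #|[set j | R j i]| < n.
  rewrite -[X in _ < X]card_ord -cardsT; apply: proper_card.
  rewrite properT; apply/eqP => /setP/(_ i).
  by rewrite !inE Rirr.
pose rank i := Ordinal (rank_lt i).
have rankW i j : R i j -> rank i < rank j.
  move=> Rij /=; apply: proper_card; apply/properP; split.
    by apply/subsetP=> k; rewrite !inE => /Rtr; apply.
  by exists i; rewrite inE ?Rirr.
have rank_inj : injective rank.
  move=> i j eq_ij; apply/eqP; apply: contraT => /Rtot/orP[] /rankW;
  by rewrite eq_ij ltnn.
exists (perm rank_inj) => i j; rewrite !permE.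
apply/idP/idP => [lt_ij|/rankW//].
have : i != j by apply: contraTneq lt_ij => ->; rewrite ltnn.
case/Rtot/orP=> // /rankW /ltn_trans /(_ lt_ij).
by rewrite ltnn.
Qed.

(** A value is the number of positions carrying smaller values, so comparisons determine it. *)
Lemma perm_lt_inj (s t : 'S_n) :
  (forall i j, (s i < s j) = (t i < t j)) -> s = t.
Proof.
have lt_card (u : 'S_n) i : u i = #|[set j | u j < u i]| :> nat.
  rewrite -(card_imset _ (@perm_inj _ u)).
  have -> : [set u j | j in [set j | u j < u i]] = [set k : 'I_n | k < u i].
    apply/setP=> k; rewrite -[k in RHS](permKV u) inE.
    by rewrite -[k in LHS](permKV u) mem_imset ?inE //; apply: perm_inj.
  rewrite cardsE -sum1_card (big_ord_narrow (ltnW (ltn_ord (u i)))).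
  by rewrite sum1_card card_ord.
move=> eq_st; apply/permP=> i; apply/val_inj; rewrite /= (lt_card s) (lt_card t).
by apply: eq_card => j; rewrite !inE eq_st.
Qed.

End OrderPermutations.

Section Postorder.
Set Implicit Arguments. Unset Strict Implicit.
Variable n : nat.
Implicit Types (p q : 'S_n) (i j k : 'I_n).

(** In the decreasing tree, the right subtree of [i] is the maximal run after [i] of values below
    [p i]. *)
Definition right_descendant p i j :=
  (i < j) && [forall k : 'I_n, (i < k <= j) ==> (p k < p i)].

(** Postorder agrees with inorder except that a node comes after its right subtree. *)
Definition postorder p i j :=
  right_descendant p j i || (i < j) && ~~ right_descendant p i j.

Lemma right_descendantP p i j :
  reflect (i < j /\ forall k, i < k <= j -> p k < p i)
          (right_descendant p i j).
Proof.
apply: (iffP andP) => -[lt_ij H]; split=> //.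
  by move=> k; apply/implyP; apply: (forallP H).
by apply/forallP=> k; apply/implyP/H.
Qed.

Lemma right_descendant_lt p i j : right_descendant p i j -> i < j.
Proof. by case/andP. Qed.

Lemma right_descendant_prefix p i j k :
  right_descendant p i k -> i < j <= k -> right_descendant p i j.
Proof.
move=> /right_descendantP[_ H] ijk; apply/right_descendantP; split; first lia.
by move=> l ilj; apply: H; lia.
Qed.

Lemma right_descendant_trans p i j k :
  right_descendant p i j -> right_descendant p j k -> right_descendant p i k.
Proof.
move=> /right_descendantP[ij Hi] /right_descendantP[jk Hj].
apply/right_descendantP; split; first lia.
move=> l ilk; case: (leqP l j) => lj; first by apply: Hi; lia.
by apply: ltn_trans (Hj l _) (Hi j _); lia.
Qed.

Lemma right_descendant_next p i j :
  j = i.+1 :> nat -> right_descendant p i j = (p j < p i).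
Proof.
move=> ji; apply/right_descendantP/idP => [[_]|lt_ji]; first by apply; lia.
split=> [|k ikj]; first lia.
by have -> : k = j by apply/val_inj => /=; lia.
Qed.

Lemma postorder_irr p : irreflexive (postorder p).
Proof. by move=> i; rewrite /postorder /right_descendant ltnn. Qed.

Lemma postorder_total p i j :
  i != j -> postorder p i j || postorder p j i.
Proof.
rewrite -val_eqE /postorder /= neq_ltn => /orP[] ->;
by case: (right_descendant p i j) (right_descendant p j i) => [] [];
rewrite ?orbT.
Qed.

Lemma postorder_ltE p i j :
  i < j -> postorder p i j = ~~ right_descendant p i j.
Proof. by move=> ij; rewrite /postorder /right_descendant ltnNge ltnW ?ij. Qed.

Lemma postorder_gtE p i j : i < j -> postorder p j i = right_descendant p i j.
Proof.
by rewrite /postorder => ij; rewrite [j < i]ltnNge (ltnW ij) orbF.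
Qed.

(** Every case rests on two facts: right subtrees are intervals starting just after their root, and
    right descent is transitive. *)
Lemma postorder_trans p : transitive (postorder p).
Proof.
move=> j i k /orP[ji|/andP[ij nij]] /orP[kj|/andP[jk njk]].
- by rewrite /postorder (right_descendant_trans kj ji).
- have lt_ji := right_descendant_lt ji.
  case: (leqP k i) => ki.
    by case/negP: njk; apply: right_descendant_prefix ji _; lia.
  rewrite postorder_ltE //; apply: contra njk.
  exact: right_descendant_trans.
- have lt_kj := right_descendant_lt kj.
  case: (ltngtP i k) => [ik|ki|/val_inj ik].
  + rewrite postorder_ltE //; apply: contra nij => ik'.
    exact: right_descendant_trans ik' kj.
  + by rewrite postorder_gtE //; apply: right_descendant_prefix kj _; lia.
  + by rewrite ik kj in nij.
- rewrite postorder_ltE ?(ltn_trans ij) //; apply: contra nij => ik.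
  by apply: right_descendant_prefix ik _; lia.
Qed.

(* The maximum of [p] on [i, j] has every later position up to [j] as a right
   descendant, so it sits at [j] when [j] is nobody's right descendant. *)
Lemma avoids132_ltE p i j : avoids132 p -> i < j ->
  (p i < p j) =
    [forall k : 'I_n, (i <= k < j) ==> ~~ right_descendant p k j].
Proof.
move=> av ij; apply/idP/forallP => [pij k|H].
  apply/implyP=> /andP[ik kj]; apply/negP => /right_descendantP[_ /(_ j)].
  rewrite kj leqnn => /(_ isT) pjk.
  case/negP: av; apply/existsP; exists i; apply/existsP; exists k.
  apply/existsP; exists j; rewrite kj pij pjk !andbT.
  rewrite ltn_neqAle ik andbT; apply: contraTneq pjk => /val_inj <-.
  by rewrite -leqNgt ltnW.
have ij_i : i <= i <= j by rewrite leqnn ltnW.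
case: (@arg_maxnP _ i (fun k : 'I_n => i <= k <= j) (fun k => p k) ij_i).
move=> m /andP[im mj] argmax.
have pmax k : i <= k <= j -> p k <= p m by apply: argmax.
have [mEj|mNj] := eqVneq m j.
  rewrite ltn_neqAle -{2}mEj (pmax i ij_i) andbT.
  apply/negP => /eqP/val_inj/perm_inj eij.
  by rewrite eij ltnn in ij.
have lt_mj : m < j by rewrite ltn_neqAle mNj.
have := H m; rewrite im lt_mj /= => /negP[].
apply/right_descendantP; split=> // k /andP[mk kj].
rewrite ltn_neqAle (pmax k) ?andbT; last by lia.
apply/negP => /eqP/val_inj/perm_inj ekm.
by rewrite ekm ltnn in mk.
Qed.

(** The tree shape determines a 132-avoiding permutation, since [avoids132_ltE] expresses every
    comparison through right subtrees. *)
Lemma right_descendant_inj p q : avoids132 p -> avoids132 q ->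
  right_descendant p =2 right_descendant q -> p = q.
Proof.
move=> avp avq eq_pq.
have ltE i j : i < j -> (p i < p j) = (q i < q j).
  move=> ij; rewrite !avoids132_ltE //.
  by apply: eq_forallb => k; rewrite eq_pq.
have gtE (s : 'S_n) i j : i < j -> (s j < s i) = ~~ (s i < s j).
  move=> ij; rewrite -leqNgt ltn_neqAle; case: eqP => //= /val_inj/perm_inj eij.
  by rewrite eij ltnn in ij.
apply: perm_lt_inj => i j; case: (ltngtP i j) => [|ji|/val_inj ->].
- exact: ltE.
- by rewrite (gtE p _ _ ji) (gtE q _ _ ji) (ltE _ _ ji).
- by rewrite !ltnn.
Qed.

(** Postorder puts descendants before their ancestor and left subtrees before right ones. After
    mirroring, values thus decrease down the tree and left subtrees carry the larger values, as
    132-avoidance requires. *)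
Definition mirror_of p q :=
  forall i j, (q (rev_ord i) < q (rev_ord j)) = postorder p i j.

Lemma mirror_exists p : exists q, mirror_of p q.
Proof.
have [] := @perm_of_order n (relpre (@rev_ord n) (postorder p)).
- by move=> i; rewrite /= postorder_irr.
- by move=> j i k; apply: postorder_trans.
- move=> i j ij; apply: postorder_total.
  by rewrite (inj_eq rev_ord_inj).
by move=> q qE; exists q => i j; rewrite qE /= !rev_ordK.
Qed.

(** Reversing positions turns a 132 pattern into [k < j < i] with [i] but not [j] in the right
    subtree of [k], which is impossible for an interval starting just after [k]. *)
Lemma mirror_avoids132 p q : mirror_of p q -> avoids132 q.
Proof.
move=> pq; apply/negP => /existsP[a /existsP[b /existsP[c]]].
rewrite -(rev_ordK a) -(rev_ordK b) -(rev_ordK c) !pq.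
move: (rev_ord a) (rev_ord b) (rev_ord c) => i j k /and3P[ij jk].
have [ji kj] : j < i /\ k < j.
  by move: (ltn_ord i) (ltn_ord j) (ltn_ord k) ij jk => /=; lia.
rewrite (postorder_gtE p (ltn_trans kj ji)) (postorder_ltE p kj).
case/andP=> ki /negP[].
by apply: right_descendant_prefix ki _; lia.
Qed.

(** For [i < j], comparing [q] at the mirrored positions reveals whether [j] is a right descendant
    of [i], so [q] determines the tree. *)
Lemma mirror_inj p1 p2 q : avoids132 p1 -> avoids132 p2 ->
  mirror_of p1 q -> mirror_of p2 q -> p1 = p2.
Proof.
move=> av1 av2 m1 m2; apply: right_descendant_inj => // i j.
have [ij|ji] := ltnP i j; last by rewrite /right_descendant ltnNge ji.
by rewrite -!postorder_gtE // -m1 -m2.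
Qed.

Lemma mem_DesE p i j : j = i.+1 :> nat -> (i \in Des p) = (p j < p i).
Proof.
move=> ji; rewrite inE; apply/existsP/idP => [[k /andP[/eqP ki]]|pji].
  by have -> : k = j by apply/val_inj; rewrite /= ji.
by exists j; rewrite ji eqxx.
Qed.

(** Reversal swaps the two neighbours, so the mirrored descent is indexed by [rev_ord j], not
    [rev_ord i]. *)
Lemma mem_Des_mirror p q i j : mirror_of p q -> j = i.+1 :> nat ->
  (rev_ord j \in Des q) = (i \notin Des p).
Proof.
move=> pq ji; have rji : rev_ord i = (rev_ord j).+1 :> nat.
  by move: (ltn_ord j) => /=; lia.
rewrite (mem_DesE _ rji) (mem_DesE _ ji) pq postorder_ltE ?ji //.
by rewrite right_descendant_next.
Qed.

Lemma Des_next p i : i \in Des p -> exists j, j = i.+1 :> nat.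
Proof. by rewrite inE => /existsP[j /andP[/eqP ji _]]; exists j. Qed.

Lemma Des_mirror_subset p1 p2 q1 q2 : mirror_of p1 q1 -> mirror_of p2 q2 ->
  (Des q2 \subset Des q1) = (Des p1 \subset Des p2).
Proof.
move=> m1 m2; apply/subsetP/subsetP => sub i iD.
  have [j ji] := Des_next iD; apply: contraLR iD.
  rewrite -(mem_Des_mirror m1 ji) -(mem_Des_mirror m2 ji); exact: sub.
(* Now [i] is a position of the mirror; the adjacent pair for [p1] and [p2] is [rev_ord j],
   [rev_ord i]. *)
have [j ji] := Des_next iD.
have rij : rev_ord i = (rev_ord j).+1 :> nat by move: (ltn_ord j) => /=; lia.
move: iD; rewrite -(rev_ordK i).
rewrite (mem_Des_mirror m1 rij) (mem_Des_mirror m2 rij).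
exact/contra/sub.
Qed.

End Postorder.

Theorem theorem2 (n : nat) (hn : 1 <= n) :
  exists psi : PA n -> PA n,
    bijective psi /\
    (forall p q : PA n, (p < q)%O <-> (psi q < psi p)%O).
Proof.
have /fin_all_exists[psi psiP] (p : PA n) : exists q : PA n, mirror_of p q.
  have [q pq] := mirror_exists p.
  by exists (MkPA (mirror_avoids132 pq)).
exists psi; split; last first.
  move=> p q; rewrite !ltPAE !properE.
  by rewrite (Des_mirror_subset (psiP p) (psiP q)) (Des_mirror_subset (psiP q) (psiP p)).
(* As [PA n] is finite, injectivity suffices. *)
apply: injF_bij => p1 p2 eq_psi; apply: val_inj.
apply: mirror_inj (PA_avoids p1) (PA_avoids p2) (psiP p1) _.
by rewrite eq_psi.
Qed.
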